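(* Let $\mathcal{L}_i\subseteq\mathbb{R}^i$ for $i=1,\ldots,m-1$ and let $\mathbf{X}\in\mathbb{R}^{n\times m}$ be the data matrix of $n$ independent observations. If $(\hat D,\hat\Lambda)$ is the maximum likelihood estimator for the Cholesky factor model $F(\mathcal{L}_1,\ldots,\mathcal{L}_{m-1})$, then for each $i=2,\ldots,m$, $\hat\Lambda_i$ is a minimizer of the problem $$\text{minimize}\quad \tfrac1n\|\mathbf{x}_i-\mathbf{Z}_i\Lambda_i^\top\|^2\quad\text{subject to}\quad \Lambda_i\in\mathcal{L}_{i-1}\subseteq\mathbb{R}^{i-1}.$$ Moreover, $$\hat D_{ii}=n\,\|\mathbf{x}_i-\mathbf{Z}_i\hat\Lambda_i^\top\|^{-2}\qquad\text{for all } i=1,\ldots,m.$$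
   Context: Cholesky factor model: given sets $\mathcal{L}_i\subseteq\mathbb{R}^i$ ($i=1,\ldots,m-1$), the model $F(\mathcal{L}_1,\ldots,\mathcal{L}_{m-1})$ consists of all centered Gaussian distributions $\mathcal{N}_m(0,\Sigma)$ whose inverse covariance matrix satisfies $K=\Sigma^{-1}=UDU^\top$, where $D$ is a diagonal matrix with strictly positive diagonal entries and $U=(I_m-\Lambda)^\top$ with $\Lambda$ a strictly lower triangular $m\times m$ matrix whose rows satisfy $\Lambda_i:=(\Lambda_{i,1},\ldots,\Lambda_{i,i-1})\in\mathcal{L}_{i-1}$ for $i=2,\ldots,m$. The pair $(D,\Lambda)$ is uniquely determined by $K$. The rows of $\mathbf{X}\in\mathbb{R}^{n\times m}$ are the observations; $\mathbf{x}_1,\ldots,\mathbf{x}_m$ are its columns, and $\mathbf{Z}_i\in\mathbb{R}^{n\times(i-1)}$ is the matrix formed by the first $i-1$ columns of $\mathbf{X}$ (for $i=1$ the term $\mathbf{Z}_1\hat\Lambda_1^\top$ is zero). $\|\cdot\|$ is the Euclidean norm. A maximum likelihood estimator is a pair $(\hat D,\hat\Lambda)$ in the model maximizing the log-likelihood $\log\det(K)-\tfrac1n\mathrm{tr}(\mathbf{X}^\top\mathbf{X}K)$ over the model. *)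

(* Defs.v *)
From mathcomp Require Import all_boot all_order all_algebra.
From mathcomp Require Import classical_sets reals exp.

Set Implicit Arguments.
Unset Strict Implicit.
Unset Printing Implicit Defensive.

Import Order.TTheory GRing.Theory Num.Theory.

Local Open Scope classical_set_scope.
Local Open Scope ring_scope.

(* Rows and columns are numbered from 0, so [i : 'I_m] stands for the 1-based
   index i + 1, and the i entries before it are those with 1-based indices
   1, ..., i. *)

(* The norm that MathComp-Analysis puts on matrices is the sup norm. *)
Definition enorm (R : realType) (n : nat) (v : 'cV[R]_n) : R :=
  Num.sqrt (\sum_k v k 0 ^+ 2).

Definition cols_before (R : realType) (p m : nat) (i : 'I_m)
    (A : 'M[R]_(p, m)) : 'M[R]_(p, i) :=
  colsub (widen_ord (ltnW (ltn_ord i))) A.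

Definition subrow (R : realType) (m : nat) (Lam : 'M[R]_m) (i : 'I_m) :
    'rV[R]_i :=
  cols_before i (row i Lam).

Definition strictly_lower (R : realType) (m : nat) (Lam : 'M[R]_m) : Prop :=
  forall i j : 'I_m, (i <= j)%N -> Lam i j = 0.

(* [L i] is only ever used for 0 < i < m. *)
Definition cholesky_params (R : realType) (m : nat)
    (L : forall i : nat, set 'rV[R]_i) (D Lam : 'M[R]_m) : Prop :=
  [/\ is_diag_mx D, (forall i, 0 < D i i), strictly_lower Lam &
      forall i : 'I_m, (0 < i)%N -> L i (subrow Lam i)].

Definition chol_U (R : realType) (m : nat) (Lam : 'M[R]_m) : 'M[R]_m :=
  (1%:M - Lam)^T.

Definition chol_K (R : realType) (m : nat) (D Lam : 'M[R]_m) : 'M[R]_m :=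
  chol_U Lam *m D *m (chol_U Lam)^T.

(* A centered Gaussian distribution is identified with its covariance matrix
   Sigma.  Symmetry and positive definiteness of Sigma follow from the
   factorization of its inverse. *)
Definition cholesky_model (R : realType) (m : nat)
    (L : forall i : nat, set 'rV[R]_i) : set 'M[R]_m :=
  [set Sigma | Sigma \in unitmx /\
     exists D Lam : 'M[R]_m,
       cholesky_params L D Lam /\ invmx Sigma = chol_K D Lam].

Definition loglik (R : realType) (n m : nat) (X : 'M[R]_(n, m))
    (K : 'M[R]_m) : R :=
  ln (\det K) - n%:R^-1 * \tr (X^T *m X *m K).

Definition is_MLE (R : realType) (n m : nat)
    (L : forall i : nat, set 'rV[R]_i) (X : 'M[R]_(n, m))
    (D Lam : 'M[R]_m) : Prop :=
  cholesky_params L D Lam /\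
  forall Sigma, cholesky_model L Sigma ->
    loglik X (invmx Sigma) <= loglik X (chol_K D Lam).

(* x_i - Z_i lam^T; for the first column Z_i is n x 0 and the product is 0. *)
Definition residual (R : realType) (n m : nat) (X : 'M[R]_(n, m)) (i : 'I_m)
    (lam : 'rV[R]_i) : 'cV[R]_n :=
  col i X - cols_before i X *m lam^T.

Definition is_minimizer (T : Type) (R : realType) (A : set T) (f : T -> R)
    (x : T) : Prop :=
  A x /\ forall y, A y -> f x <= f y.

(* Main.v *)
Require Import Defs.
From mathcomp Require Import all_boot all_order all_algebra.
From mathcomp Require Import classical_sets reals exp.
From mathcomp Require Import lra.

(** With U = (1 - Lam)^T, the matrix X U has the residuals
    r_i = x_i - Z_i Lam_i^T as its columns, and U is unipotent, so that

      log det K - tr (X^T X K) / n = \sum_i (ln D_ii - D_ii * ||r_i||^2 / n).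

    The term of index i depends on D_ii and on the row Lam_i only
    (loglik_chol_K), and the constraints of the model also bear on each D_ii
    and each Lam_i separately.  At a maximizer, replacing one pair
    (D_ii, Lam_i) by another admissible pair therefore cannot increase the
    i-th term (MLE_row_max).

    With D_ii kept, this says that Lam_i minimizes the residual sum of
    squares, because D_ii > 0.  With Lam_i kept, it says that D_ii maximizes
    d |-> ln d - d c over d > 0, where c = ||r_i||^2 / n; the strict concavity
    of ln forces D_ii = 1 / c (max_ln_sub_linear). *)

Set Implicit Arguments.
Unset Strict Implicit.
Unset Printing Implicit Defensive.

Import Order.TTheory GRing.Theory Num.Theory.

Local Open Scope classical_set_scope.
Local Open Scope ring_scope.

Lemma enorm_sqr (R : realType) (n : nat) (v : 'cV[R]_n) :
  enorm v ^+ 2 = \sum_k v k 0 ^+ 2.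
Proof. by rewrite sqr_sqrtr// sumr_ge0// => k _; exact: sqr_ge0. Qed.

Lemma det_chol_U (R : realType) (m : nat) (Lam : 'M[R]_m) :
  strictly_lower Lam -> \det (chol_U Lam) = 1.
Proof.
move=> lowL; rewrite det_tr det_trig; last first.
  apply/is_trig_mxP => i j ltij.
  by rewrite !mxE lowL ?(ltnW ltij)// subr0 -val_eqE/= ltn_eqF.
by rewrite big1// => i _; rewrite !mxE lowL// eqxx subr0.
Qed.

Lemma det_chol_K (R : realType) (m : nat) (D Lam : 'M[R]_m) :
  is_diag_mx D -> strictly_lower Lam -> \det (chol_K D Lam) = \prod_i D i i.
Proof.
move=> /diag_mxP[d ->] lowL.
rewrite /chol_K !det_mulmx (det_tr (chol_U Lam)) det_chol_U// mul1r mulr1 det_diag.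
by apply: eq_bigr => i _; rewrite !mxE eqxx.
Qed.

Lemma sum_widen_ord (R : realType) (m : nat) (i : 'I_m) (F : 'I_m -> R) :
  (forall k : 'I_m, (i <= k)%N -> F k = 0) ->
  \sum_k F k = \sum_(k < i) F (widen_ord (ltnW (ltn_ord i)) k).
Proof.
move=> F0; rewrite -(big_ord_narrow (ltnW (ltn_ord i))) [RHS]big_mkcond /=.
by apply: eq_bigr => k _; case: ltnP => // /F0.
Qed.

(** Column i of X Lam^T combines all the columns of X, with the entries of row i
    of Lam as coefficients; it reduces to Z_i Lam_i^T because the entries of
    index at least i vanish. *)
Lemma col_mulmx_chol_U (R : realType) (n m : nat) (X : 'M[R]_(n, m))
    (Lam : 'M[R]_m) (i : 'I_m) :
  strictly_lower Lam -> col i (X *m chol_U Lam) = residual X (subrow Lam i).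
Proof.
move=> lowL; apply/colP => k.
rewrite /residual /chol_U linearB/= trmx1 mulmxBr mulmx1 !mxE; congr (_ - _).
rewrite (sum_widen_ord (i := i)) => [|j leij]; last by rewrite mxE lowL ?mulr0.
by apply: eq_bigr => j _; rewrite !mxE.
Qed.

Lemma mxtrace_chol_K (R : realType) (n m : nat) (X : 'M[R]_(n, m))
    (D Lam : 'M[R]_m) :
  is_diag_mx D -> strictly_lower Lam ->
  \tr (X^T *m X *m chol_K D Lam) =
  \sum_i D i i * enorm (residual X (subrow Lam i)) ^+ 2.
Proof.
move=> /diag_mxP[d ->] lowL.
(* Cyclicity of the trace turns this into the trace of (XU)^T (XU) D. *)
rewrite /chol_K !mulmxA mxtrace_mulC !mulmxA -trmx_mul -mulmxA -mulmxA.
rewrite (mulmxA X) mulmxA mul_mx_diag /mxtrace.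
apply: eq_bigr => i _; rewrite !mxE eqxx mulr1n mulrC; congr (_ * _).
rewrite enorm_sqr -col_mulmx_chol_U//.
by apply: eq_bigr => k _; rewrite !mxE expr2.
Qed.

(** The contribution to the log-likelihood of a variable with diagonal entry d
    and coefficients lam in its regression on the preceding variables. *)
Definition row_loglik (R : realType) (n m : nat) (X : 'M[R]_(n, m)) (i : 'I_m)
    (d : R) (lam : 'rV[R]_i) : R :=
  ln d - d * (n%:R^-1 * enorm (residual X lam) ^+ 2).

Lemma ln_prod_gt0 (R : realType) (I : Type) (r : seq I) (F : I -> R) :
  (forall i, 0 < F i) -> ln (\prod_(i <- r) F i) = \sum_(i <- r) ln (F i).
Proof.
move=> F0; elim: r => [|i r IH]; first by rewrite !big_nil ln1.
by rewrite !big_cons lnM ?IH// posrE// prodr_gt0.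
Qed.

Lemma loglik_chol_K (R : realType) (n m : nat) (X : 'M[R]_(n, m))
    (L : forall i : nat, set 'rV[R]_i) (D Lam : 'M[R]_m) :
  cholesky_params L D Lam ->
  loglik X (chol_K D Lam) =
  \sum_i row_loglik X (D i i) (subrow Lam i).
Proof.
move=> [diagD D0 lowL _].
rewrite /loglik det_chol_K// ln_prod_gt0// mxtrace_chol_K// mulr_sumr -sumrB.
by apply: eq_bigr => i _; rewrite /row_loglik mulrCA.
Qed.

Definition set_diag (R : realType) (m : nat) (D : 'M[R]_m) (i : 'I_m) (d : R)
    : 'M[R]_m :=
  diag_mx (\row_j (if j == i then d else D j j)).

(** The default value 0, taken from the diagonal on, keeps the matrix strictly
    lower triangular. *)
Definition set_subrow (R : realType) (m : nat) (Lam : 'M[R]_m) (i : 'I_m)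
    (lam : 'rV[R]_i) : 'M[R]_m :=
  \matrix_(a, b) (if a == i then oapp (lam 0) 0 (insub (val b)) else Lam a b).

Lemma set_diagE (R : realType) (m : nat) (D : 'M[R]_m) (i j : 'I_m) (d : R) :
  set_diag D i d j j = if j == i then d else D j j.
Proof. by rewrite !mxE eqxx. Qed.

Lemma subrow_set_subrow (R : realType) (m : nat) (Lam : 'M[R]_m) (i : 'I_m)
    (lam : 'rV[R]_i) : subrow (set_subrow Lam lam) i = lam.
Proof. by apply/rowP => k; rewrite !mxE eqxx/= valK. Qed.

Lemma subrow_set_subrow_neq (R : realType) (m : nat) (Lam : 'M[R]_m)
    (i j : 'I_m) (lam : 'rV[R]_i) :
  j != i -> subrow (set_subrow Lam lam) j = subrow Lam j.
Proof. by move=> /negPf ji; apply/rowP => k; rewrite !mxE ji. Qed.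

Lemma cholesky_params_set (R : realType) (m : nat)
    (L : forall i : nat, set 'rV[R]_i) (D Lam : 'M[R]_m) (i : 'I_m) (d : R)
    (lam : 'rV[R]_i) :
  cholesky_params L D Lam -> 0 < d -> ((0 < i)%N -> L i lam) ->
  cholesky_params L (set_diag D i d) (set_subrow Lam lam).
Proof.
move=> [diagD D0 lowL inL] d0 Llam; split.
- exact: diag_mx_is_diag.
- by move=> j; rewrite set_diagE; case: ifP.
- move=> a b leab; rewrite mxE; case: eqP => [ai|_]; last exact: lowL.
  by rewrite insubN// -leqNgt -ai.
- move=> j j0; have [ji|ji] := eqVneq j i.
    by subst j; rewrite subrow_set_subrow; exact: Llam.
  by rewrite subrow_set_subrow_neq//; exact: inL.
Qed.

(** The model consists of covariance matrices; positivity of det K makes every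
    K = U D U^T the inverse of one of them. *)
Lemma MLE_loglik_max (R : realType) (n m : nat)
    (L : forall i : nat, set 'rV[R]_i) (X : 'M[R]_(n, m))
    (D Lam D' Lam' : 'M[R]_m) :
  is_MLE L X D Lam -> cholesky_params L D' Lam' ->
  loglik X (chol_K D' Lam') <= loglik X (chol_K D Lam).
Proof.
move=> [_ maxK] par'; rewrite -[chol_K D' Lam']invmxK; apply: maxK.
have [diagD' D'0 lowL' _] := par'.
split; last by exists D', Lam'; rewrite invmxK.
by rewrite unitmx_inv unitmxE det_chol_K// unitfE gt_eqF// prodr_gt0.
Qed.

Lemma MLE_row_max (R : realType) (n m : nat)
    (L : forall i : nat, set 'rV[R]_i) (X : 'M[R]_(n, m)) (D Lam : 'M[R]_m)
    (i : 'I_m) (d : R) (lam : 'rV[R]_i) :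
  is_MLE L X D Lam -> 0 < d -> ((0 < i)%N -> L i lam) ->
  row_loglik X d lam <= row_loglik X (D i i) (subrow Lam i).
Proof.
move=> mle d0 Llam.
have par' := cholesky_params_set (proj1 mle) d0 Llam.
have := MLE_loglik_max mle par'.
rewrite (loglik_chol_K X par') (loglik_chol_K X (proj1 mle)).
rewrite (bigD1 i)//= [leRHS](bigD1 i)//= set_diagE eqxx subrow_set_subrow.
rewrite (eq_bigr (fun j => row_loglik X (D j j) (subrow Lam j))) ?lerD2r//.
by move=> j ji; rewrite set_diagE (negPf ji) subrow_set_subrow_neq.
Qed.

(** For c > 0, comparing d with 1 / c gives d c - 1 <= ln (d c), which holds
    only at d c = 1.  For c = 0, doubling d shows that there is no maximizer;
    this rules out both an empty sample and a zero residual. *)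
Lemma max_ln_sub_linear (R : realType) (c d : R) :
  0 <= c -> 0 < d -> (forall e, 0 < e -> ln e - e * c <= ln d - d * c) ->
  d = c^-1.
Proof.
rewrite le_eqVlt => /predU1P[<- d0 maxd|c0 d0 maxd].
  have d20 : 0 < d * 2 by rewrite mulr_gt0.
  have := maxd _ d20; rewrite !mulr0 !subr0 ler_ln ?posrE//.
  by rewrite ger_pMr// lern1.
have dc0 : 0 < d * c by rewrite mulr_gt0.
have ineq : d * c <= 1 + ln (d * c).
  have := maxd c^-1; rewrite invr_gt0 => /(_ c0).
  rewrite mulVf ?gt_eqF// lnM ?posrE// lnV ?posrE//.
  lra.
have [ln0|/expR_gt1Dx] := eqVneq (ln (d * c)) 0; last first.
  by rewrite lnK ?posrE// ltNge ineq.
have dc1 : d * c = 1 by rewrite -[LHS]lnK ?posrE// ln0 expR0.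
by rewrite -[d](mulfK (lt0r_neq0 c0)) dc1 mul1r.
Qed.

Theorem theorem5p4 (R : realType) (n m : nat)
    (L : forall i : nat, set 'rV[R]_i) (X : 'M[R]_(n, m)) (D Lam : 'M[R]_m)
    (hMLE : is_MLE L X D Lam) :
  (forall i : 'I_m, (0 < i)%N ->
     is_minimizer (L i)
       (fun lam : 'rV[R]_i => n%:R^-1 * enorm (residual X lam) ^+ 2)
       (subrow Lam i)) /\
  (forall i : 'I_m, D i i = n%:R * enorm (residual X (subrow Lam i)) ^- 2).
Proof.
have [_ D0 _ inL] := proj1 hMLE.
split=> i.
  move=> i0; split; first exact: inL.
  move=> lam Llam; have := MLE_row_max hMLE (D0 i) (fun=> Llam).
  by rewrite /row_loglik lerD2l lerN2 ler_pM2l.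
rewrite -[n%:R in RHS]invrK -invfM; apply: max_ln_sub_linear => //.
  by rewrite mulr_ge0 ?invr_ge0 ?ler0n ?sqr_ge0.
by move=> e e0; exact: (MLE_row_max hMLE e0 (inL i)).
Qed.
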